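(* For every $T>0$, $$\lim_{N\to\infty}\ \sup_{\xi\in\mathcal E_N}\ \mathrm E^{\mathbb P^N_\xi}\left[\int_0^T \mathbf 1\{\eta_N(t)\in\Omega_N\setminus\mathcal E_N\}\,\mathrm dt\right]=0 .$$
   Context: Standing assumptions. Fix an integer $k\ge1$ and $\rho>0$. $L=L(N)$ are positive integers with $L\to\infty$ and $N/L(N)\to\rho$ as $N\to\infty$. $(d_N)$ are positive reals with $\lim_{N\to\infty}d_NN^3\log N=0$, and $\theta_N:=N^2/d_N$. Inclusion process. $\mathbb T_L:=\mathbb Z/(L\mathbb Z)$; $\Omega_N:=\{\eta\in\mathbb N_0^{\mathbb T_L}:\sum_{x}\eta_x=N\}$, where $\mathbb N_0=\{0,1,2,\dots\}$, $\mathbb N=\{1,2,\dots\}$; $\delta^z$ is the configuration with a single particle at $z$. $(\eta_N(t))_{t\ge0}$ is the continuous-time Markov chain on $\Omega_N$ with generator $$\mathcal L_Nf(\eta)=\sum_{x\in\mathbb T_L}\sum_{y\in\{x+1,x-1\}}\theta_N\,\eta_x(d_N+\eta_y)\bigl(f(\eta-\delta^x+\delta^y)-f(\eta)\bigr).$$ $\mathbb P^N_\eta$ is its law on $D([0,\infty);\Omega_N)$ when started at $\eta$. $\mathrm E^Q$ is the expectation under $Q$. Condensed configurations. For $\ell\in\{1,\dots,k\}$, $\mathbf N_N^\ell:=\{\boldsymbol n\in\mathbb N^\ell:n_1+\dots+n_\ell=N\}$, and $\mathbb I_L^\ell$ is the set of $\boldsymbol x\in\mathbb T_L^\ell$ such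 that (i) $0<x_2-x_1<\dots<x_\ell-x_1<L$, where each $x_i-x_1$ is represented in $\{0,\dots,L-1\}$, and (ii) any two of the sites $x_1,\dots,x_\ell$ are either equal or at graph distance at least $2$ in $\mathbb T_L$. For $\boldsymbol x\in\mathbb I_L^\ell$, $\boldsymbol n\in\mathbf N_N^\ell$, put $\xi_{\boldsymbol n}^{\boldsymbol x}:=\sum_{i=1}^\ell n_i\delta^{x_i}\in\Omega_N$. Let $\mathcal E_N^\ell:=\{\xi_{\boldsymbol n}^{\boldsymbol x}:\boldsymbol x\in\mathbb I_L^\ell,\boldsymbol n\in\mathbf N_N^\ell\}$ and $\mathcal E_N:=\bigcup_{\ell=1}^k\mathcal E_N^\ell$. *)

(* Defs.v *)
From HB Require Import structures.
From mathcomp Require Import all_boot all_order all_algebra.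
From mathcomp Require Import all_classical all_reals all_analysis.

Set Implicit Arguments.
Unset Strict Implicit.
Unset Printing Implicit Defensive.

Import Order.TTheory GRing.Theory Num.Theory.
Import numFieldNormedType.Exports.

Local Open Scope classical_set_scope.
Local Open Scope ring_scope.

(* The path space D([0, oo); S) for a discrete state space S. Paths are
   functions on R; they are extended to negative times by their value at 0, so
   that a path is determined by its restriction to [0, oo). In a discrete space
   a one-sided limit exists iff the path is constant on a one-sided punctured
   neighbourhood. *)
Record cadlag (R : realType) (S : Type) := Cadlag {
  cadlag_fun :> R -> S;
  cadlag_neg : forall t, t <= 0 -> cadlag_fun t = cadlag_fun 0;
  cadlag_right : forall t, 0 <= t -> \forall s \near t^'+, cadlag_fun s = cadlag_fun t;
  cadlag_left : forall t, 0 < t -> exists x, \forall s \near t^'-, cadlag_fun s = x }.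

Definition cadlag_cst (R : realType) (S : Type) (x : S) : cadlag R S.
Proof.
by exists (fun=> x) => // t _; [exact: nearW | exists x; exact: nearW].
Defined.

HB.instance Definition _ (R : realType) (S : Type) := gen_eqMixin (cadlag R S).
HB.instance Definition _ (R : realType) (S : Type) :=
  gen_choiceMixin (cadlag R S).
HB.instance Definition _ (R : realType) (S : pointedType) :=
  isPointed.Build (cadlag R S) (cadlag_cst R (@point S)).

(* The sigma-algebra on D([0, oo); S) generated by the coordinate maps, for a
   countable state space S. *)
Definition coordinate_events (R : realType) (S : Type) : set (set (cadlag R S)) :=
  [set A | exists t x, 0 <= t /\ A = [set w : cadlag R S | w t = x]].

Definition path_space (R : realType) (S : pointedType) :=
  g_sigma_algebraType (@coordinate_events R S).

(* (exp (t * gen) f) x, as the exponential series; it converges for a generator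
   with bounded rates and a bounded function f. *)
Definition semigroup (R : realType) (S : Type) (gen : (S -> R) -> S -> R)
    (t : R) (f : S -> R) (x : S) : R :=
  limn (series (fun m : nat => t ^+ m / m`!%:R * iter m gen f x)).

Definition transition (R : realType) (S : Type) (gen : (S -> R) -> S -> R)
    (t : R) (x y : S) : R :=
  semigroup gen t (\1_[set y]) x.

(* For s = [:: (h_1, y_1); ...; (h_m, y_m)], the path is at y_i at time
   t + h_1 + ... + h_i for every i. *)
Fixpoint visits (R : realType) (S : Type) (w : cadlag R S) (t : R)
    (s : seq (R * S)) : Prop :=
  if s is (h, y) :: s' then w (t + h) = y /\ visits w (t + h) s' else True.

Fixpoint transitions (R : realType) (S : Type) (gen : (S -> R) -> S -> R)
    (x : S) (s : seq (R * S)) : R :=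
  if s is (h, y) :: s' then transition gen h x y * transitions gen y s' else 1.

(* P is the law of the continuous-time Markov chain with generator gen started
   at x, specified by its finite-dimensional distributions. *)
Definition markov_law (R : realType) (S : pointedType)
    (gen : (S -> R) -> S -> R) (x : S) (P : probability (path_space R S) R) :=
  P [set w : cadlag R S | w 0 = x] = 1%E /\
  forall s : seq (R * S), all (fun hy => 0 <= hy.1) s ->
    P [set w : cadlag R S | visits w 0 s] = (transitions gen x s)%:E.

(* Z/LZ for L > 0, with representatives in {0, ..., L - 1} and its additive
   group structure from zmodp; the form n.+1 is needed for that structure. *)
Notation torus L := 'I_(L.-1.+1).

Definition torus_nbr (L : nat) (x : torus L) : {set torus L} :=
  [set x + Zp1; x - Zp1]%SET.

(* The representative of y - x in {0, ..., L - 1}, that is, the length of the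
   arc of the cycle from x to y in the positive direction. *)
Definition arc_length (L : nat) (x y : torus L) : nat := val (y - x).

(* The graph distance of the cycle is the length of the shorter of the two
   arcs. *)
Definition torus_dist (L : nat) (x y : torus L) : nat :=
  minn (arc_length x y) (arc_length y x).

Record Omega (L N : nat) := Config {
  occupation :> {ffun torus L -> nat};
  occupationP : (\sum_x occupation x == N)%N }.

HB.instance Definition _ (L N : nat) := [isSub for @occupation L N].
HB.instance Definition _ (L N : nat) := [Choice of Omega L N by <:].

Lemma sum_delta (L N : nat) (x0 : torus L) :
  (\sum_x [ffun x => N * (x == x0)] x == N)%N.
Proof.
rewrite (bigD1 x0)//= ffunE eqxx muln1 big1 ?addn0// => x /negPf xx0.
by rewrite ffunE xx0 muln0.
Qed.

HB.instance Definition _ (L N : nat) :=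
  isPointed.Build (Omega L N) (Config (sum_delta N (ord0 : torus L))).

(* eta - delta^x + delta^y if eta x > 0. If eta x = 0, the truncated subtraction
   leaves N + 1 particles, so insubd returns eta; the jump rate is then 0. *)
Definition hop (L N : nat) (eta : Omega L N) (x y : torus L) : Omega L N :=
  insubd eta [ffun z => (eta z - (z == x) + (z == y))%N].

Definition inclusion_gen (R : realType) (L N : nat) (theta d : R)
    (f : Omega L N -> R) (eta : Omega L N) : R :=
  \sum_(x : torus L) \sum_(y in torus_nbr x)
    theta * (eta x)%:R * (d + (eta y)%:R) * (f (hop eta x y) - f eta).

(* The index set I_L^l; the entries x_1, ..., x_l are indexed by 'I_l from 0,
   and l = m.+1 is positive. *)
Definition admissible (L m : nat) (x : 'I_m.+1 -> torus L) : Prop :=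
  (forall i j : 'I_m.+1,
     (i < j)%N -> (arc_length (x ord0) (x i) < arc_length (x ord0) (x j))%N) /\
  (forall i j, x i = x j \/ (2 <= torus_dist (x i) (x j))%N).

Definition condensate (L m : nat) (x : 'I_m.+1 -> torus L)
    (n : 'I_m.+1 -> nat) : {ffun torus L -> nat} :=
  [ffun z => (\sum_i n i * (z == x i))%N].

(* The set E_N^l of condensed configurations for l = m.+1. *)
Definition condensed_with (L N m : nat) : set (Omega L N) :=
  [set xi | exists (x : 'I_m.+1 -> torus L) (n : 'I_m.+1 -> nat),
    [/\ admissible x, (forall i, (0 < n i)%N), (\sum_i n i)%N = N &
        xi = condensate x n :> {ffun torus L -> nat}]].

Arguments condensed_with : clear implicits.

Definition condensed (k L N : nat) : set (Omega L N) :=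
  \bigcup_(m < k) condensed_with L N m.
Arguments condensed : clear implicits.

(* Main.v *)
Require Import Defs.
From HB Require Import structures.
From mathcomp Require Import all_boot all_order all_algebra.
From mathcomp Require Import all_classical all_reals all_analysis.
From mathcomp Require Import measurable_realfun ring lra.

Import Order.TTheory GRing.Theory Num.Theory.
Import numFieldNormedType.Exports.

(* A configuration is condensed iff it is dispersed: its occupied sites form an
   independent set of at most k sites. A hop onto an empty site turns it into
   a cluster: a centre y such that all edges between occupied sites contain y.
   If d = 0, the number b of particles at y performs a birth-death chain with
   both rates theta * b * m, m being the number of particles at the neighbours
   of y, until b = 0 or m = 0, when the configuration is dispersed again.
   The mean duration of this excursion is absorption_time b m / theta, which is
   of order log N / (theta * n) when a pile of n particles emits one particle.

   A large enough multiple of the mean duration, completed by 0 on dispersed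
   configurations and by 1 on those that are neither dispersed nor clustered,
   is a function V in [0, 1] with gen V <= eps and
   1_{not dispersed} <= eps + V - gen V, where eps = O(d N^3 log N). Dynkin's
   formula gives P_t V <= eps t from a condensed configuration, and then the
   mean time spent outside condensed configurations before T is at most
   eps T (1 + T). *)

(** * Hops on dispersed and clustered configurations *)

Section Torus.
Context (L : nat).
Implicit Types (x y z : torus L) (X Y : {set torus L}).
Local Open Scope ring_scope.

Lemma torus_nbr_sym x y : (y \in torus_nbr x) = (x \in torus_nbr y).
Proof.
rewrite !in_set2 -subr_eq eq_sym orbC; congr (_ || _).
by rewrite [RHS]eq_sym -subr_eq opprK.
Qed.

Lemma val_Zp1 : (1 < L)%N -> val (Zp1 : torus L) = 1%N.
Proof. by move=> L1; rewrite /= modn_small// prednK// ltnW. Qed.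

(** Rests on [Zp1] being nonzero; for [L = 1] every site would be its own neighbour. *)
Lemma torus_nbr_irr x : (1 < L)%N -> x \notin torus_nbr x.
Proof.
move=> L1; have Zp1_neq0 : (Zp1 : torus L) != 0.
  by apply/eqP => /(congr1 val); rewrite val_Zp1.
rewrite in_set2 negb_or -{1}[x]addr0 -{3}[x]subr0.
by rewrite (inj_eq (addrI x)) (inj_eq (addrI x)) (inj_eq oppr_inj) eq_sym Zp1_neq0.
Qed.

Lemma card_torus_nbr x : (#|torus_nbr x| <= 2)%N.
Proof. by rewrite cards2; case: (_ != _). Qed.

Definition independent X := [forall x in X, [forall z in X, z \notin torus_nbr x]].

Lemma independentP X :
  reflect (forall x z, x \in X -> z \in X -> z \notin torus_nbr x) (independent X).
Proof.
apply: (iffP forall_inP) => [H x z xX zX|H x xX].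
  exact: (forall_inP (H x xX)).
by apply/forall_inP => z zX; exact: H.
Qed.

Lemma independentS X Y : X \subset Y -> independent Y -> independent X.
Proof.
move=> /fintype.subsetP XY /independentP iY; apply/independentP => x z xX zX.
by apply: iY; exact: XY.
Qed.

End Torus.
Arguments independent {L}.

Section Configurations.
Context (k L N : nat) (L1 : (1 < L)%N).
Implicit Types (x y z : torus L) (eta : Omega L N).

(** The new occupation numbers still sum to [N], so [insubd] does not fall back on its default
    [eta]. *)
Lemma hopE eta x y z : 0 < eta x -> x != y ->
  hop eta x y z = eta z - (z == x) + (z == y).
Proof.
move=> etax xy.
have sumN : \sum_u [ffun z => eta z - (z == x) + (z == y)] u == N.
  rewrite -[X in _ == X](eqP (occupationP eta)); apply/eqP.
  under eq_bigr do rewrite ffunE.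
  rewrite big_split/= [X in _ + X = _](bigD1 y)//= eqxx.
  rewrite [X in _ + (_ + X) = _]big1 => [|u /negPf ->//].
  rewrite addn0 (bigD1 x)//= [in RHS](bigD1 x)//= eqxx addnAC subnK//.
  congr (_ + _).
  by apply: eq_bigr => u /negPf ->; rewrite subn0.
pose sum_eqN (f : {ffun torus L -> nat}) := \sum_u f u == N.
by rewrite /hop /insubd (insubT sum_eqN sumN) ffunE.
Qed.

Definition occupied eta : {set torus L} := [set z | 0 < eta z].

Lemma in_occupied eta z : (z \in occupied eta) = (0 < eta z).
Proof. by rewrite inE. Qed.

Definition nbr_mass eta y := \sum_(z in torus_nbr y) eta z.

Definition dispersed eta := independent (occupied eta) && (#|occupied eta| <= k).

(** The centre is exempt from the bound [k]: a particle emitted by one of [k] piles occupies one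
    more site, which serves as the centre. *)
Definition clustered y eta :=
  [&& 0 < eta y, 0 < nbr_mass eta y, independent (occupied eta :\ y)
    & #|occupied eta :\ y| <= k].

Lemma le_occupation eta z : eta z <= N.
Proof. by rewrite -[leqRHS](eqP (occupationP eta)) (bigD1 z)//= leq_addr. Qed.

Lemma le_nbr_mass eta y : eta y + nbr_mass eta y <= N.
Proof.
rewrite -[leqRHS](eqP (occupationP eta)) (bigD1 y)//= leq_add2l.
rewrite /nbr_mass [leqRHS](bigID [in torus_nbr y])/=.
apply: leq_trans (leq_addr _ _).
rewrite [leqRHS](eq_bigl [in torus_nbr y])// => z.
by apply: andb_idl => zy; apply: contraTneq zy => ->; exact: torus_nbr_irr.
Qed.

Lemma le_nbr_mass_nbr eta y z : z \in torus_nbr y -> eta z <= nbr_mass eta y.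
Proof. by move=> zy; rewrite /nbr_mass (bigD1 z)//= leq_addr. Qed.

Section Hop.
Variables (eta : Omega L N) (y z : torus L).
Let occE := (in_occupied, in_setD1).
Hypotheses (zy : z \in torus_nbr y).

Let yz : y != z.
Proof. by apply: contraTneq zy => <-; exact: torus_nbr_irr. Qed.

Let zNy : z != y. Proof. by rewrite eq_sym. Qed.

(** With [b = eta y] and [m = nbr_mass eta y], this and [hop_to] are the two moves of the
    birth-death chain; [b + m] is conserved. *)
Lemma hop_from : 0 < eta y ->
  hop eta y z y = (eta y).-1 /\ nbr_mass (hop eta y z) y = (nbr_mass eta y).+1.
Proof.
move=> etay; rewrite hopE// eqxx (negPf yz) addn0 subn1; split=> //.
rewrite /nbr_mass !(bigD1 (P := [in torus_nbr y]) z)//= hopE// eqxx.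
rewrite (negPf zNy) subn0 addn1 addSn; congr (_ + _).+1.
apply: eq_bigr => u /andP[uy /negPf uz]; rewrite hopE// uz addn0.
have -> : (u == y) = false by apply: contraTF uy => /eqP ->; exact: torus_nbr_irr.
by rewrite subn0.
Qed.

Lemma hop_to : 0 < eta z ->
  hop eta z y y = (eta y).+1 /\ nbr_mass (hop eta z y) y = (nbr_mass eta y).-1.
Proof.
move=> etaz; rewrite hopE// eqxx (negPf yz) subn0 addn1; split=> //.
rewrite /nbr_mass !(bigD1 (P := [in torus_nbr y]) z)//= hopE// eqxx.
rewrite (negPf zNy) addn0 subn1 -[in RHS](prednK etaz) addSn/=; congr (_ + _).
apply: eq_bigr => u /andP[uy /negPf uz]; rewrite hopE// uz subn0.
have -> : (u == y) = false by apply: contraTF uy => /eqP ->; exact: torus_nbr_irr.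
by rewrite addn0.
Qed.

(** The occupation of [y] is arbitrary, to cover both the start of an excursion and a move towards
    the centre of a cluster. No site other than [y] becomes occupied; hence the result is clustered
    at [y] unless the neighbours of [y] are empty, and then [y] is isolated. *)
Lemma hop_to_dispersed : 0 < eta z -> independent (occupied eta :\ y) ->
  #|occupied eta :\ y| <= k ->
  dispersed (hop eta z y) || clustered y (hop eta z y).
Proof.
move=> etaz ind card; have [hy hm] := hop_to etaz.
have sub : occupied (hop eta z y) :\ y \subset occupied eta :\ y.
  apply/fintype.subsetP => u; rewrite !occE => /andP[uy]; rewrite uy hopE//=.
  by rewrite (negPf uy) addn0 => /leq_trans; apply; exact: leq_subr.
have [m0|m0] := posnP (nbr_mass (hop eta z y) y); last first.
  apply/orP; right; rewrite /clustered hy m0/= (independentS _ _ _ sub)//=.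
  exact: leq_trans (subset_leq_card sub) card.
have hyN u : 0 < hop eta z y u -> u \notin torus_nbr y.
  apply: contraL => uy; rewrite -leqNgt -m0; exact: le_nbr_mass_nbr.
apply/orP; left; apply/andP; split.
  apply/independentP => u v; rewrite !occE => hu hv; apply/negP => vu.
  have uy : u != y by apply: contraTneq vu => ->; exact: hyN.
  have vy : v != y by apply: contraTneq vu => ->; rewrite torus_nbr_sym hyN.
  have iu : u \in occupied eta :\ y by apply: (fintype.subsetP sub); rewrite !occE uy.
  have iv : v \in occupied eta :\ y by apply: (fintype.subsetP sub); rewrite !occE vy.
  by move/independentP: ind => /(_ u v iu iv); rewrite vu.
(* The hop has emptied [z], which leaves room for [y] in the bound [k]. *)
have zX : z \in occupied eta :\ y by rewrite !occE eq_sym yz.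
have subz : occupied (hop eta z y) :\ y \subset (occupied eta :\ y) :\ z.
  apply/fintype.subsetP => u uX; rewrite in_setD1 (fintype.subsetP sub)// andbT.
  apply: contraTneq uX => ->; rewrite !occE negb_and; apply/orP; right.
  by apply: contraL zy; exact: hyN.
apply: (@leq_trans (1 + #|occupied (hop eta z y) :\ y|)).
  by rewrite [leqLHS](cardsD1 y) leq_add2r leq_b1.
by apply: leq_trans card; rewrite [leqRHS](cardsD1 z) zX leq_add2l subset_leq_card.
Qed.

(** As [z] is already occupied, no site becomes occupied. If the hop empties [y], only sites of the
    independent set [occupied eta :\ y] remain. *)
Lemma hop_from_dispersed : clustered y eta -> 0 < eta z ->
  dispersed (hop eta y z) || clustered y (hop eta y z).
Proof.
move=> /and4P[etay m0 ind card] etaz; have [hy hm] := hop_from etay.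
have sub : occupied (hop eta y z) \subset occupied eta.
  apply/fintype.subsetP => u; rewrite !occE hopE//.
  have [->|uz] := eqVneq u z; first by rewrite etaz.
  by rewrite addn0 => /leq_trans; apply; exact: leq_subr.
have [y0|y0] := posnP (hop eta y z y).
  have suby : occupied (hop eta y z) \subset occupied eta :\ y.
    apply/fintype.subsetP => u uX; rewrite in_setD1 (fintype.subsetP sub)// andbT.
    by apply: contraTneq uX => ->; rewrite !occE y0.
  apply/orP; left; rewrite /dispersed (independentS _ _ _ suby)//=.
  exact: leq_trans (subset_leq_card suby) card.
have suby : occupied (hop eta y z) :\ y \subset occupied eta :\ y by exact: finset.setSD.
apply/orP; right; rewrite /clustered y0 hm/= (independentS _ _ _ suby)//=.
exact: leq_trans (subset_leq_card suby) card.
Qed.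

End Hop.

End Configurations.
Arguments occupied {L N}.
Arguments nbr_mass {L N}.
Arguments dispersed k {L N}.
Arguments clustered k {L N}.

(** * The Lyapunov function *)

Section AbsorptionTime.
Context {R : realType}.
Local Open Scope ring_scope.

Definition harmonic_sum (n : nat) : R := \sum_(i < n) i.+1%:R^-1.

(** Equal to [n * harmonic_sum n - n], a discrete version of [n log n]; its second difference at
    [n > 0] is [1 / n]. *)
Definition harmonic_sum2 (n : nat) : R := \sum_(i < n) harmonic_sum i.

(* The solution f of
   b * m * (f (b - 1) (m + 1) + f (b + 1) (m - 1) - 2 * f b m) = - 1
   that vanishes if b = 0 or m = 0. *)
Definition absorption_time (b m : nat) : R :=
  (harmonic_sum2 (b + m) - harmonic_sum2 b - harmonic_sum2 m) / (b + m)%:R.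

Lemma harmonic_sumS n : harmonic_sum n.+1 = harmonic_sum n + n.+1%:R^-1.
Proof. by rewrite /harmonic_sum big_ord_recr. Qed.

Lemma harmonic_sum2S n : harmonic_sum2 n.+1 = harmonic_sum2 n + harmonic_sum n.
Proof. by rewrite /harmonic_sum2 big_ord_recr. Qed.

Lemma harmonic_sum_ge0 n : 0 <= harmonic_sum n.
Proof. by apply: sumr_ge0 => i _; rewrite invr_ge0. Qed.

Lemma le_harmonic_sum m n : (m <= n)%N -> harmonic_sum m <= harmonic_sum n.
Proof.
move=> /subnKC <-; elim: (n - m)%N => [|j IHj]; first by rewrite addn0.
by rewrite addnS harmonic_sumS ler_wpDr ?invr_ge0.
Qed.

(** The increments [harmonic_sum] are nondecreasing. Superadditivity makes [absorption_time]
    nonnegative. *)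
Lemma harmonic_sum2_super b m :
  harmonic_sum2 b + harmonic_sum2 m <= harmonic_sum2 (b + m).
Proof.
elim: b => [|b IHb]; first by rewrite /harmonic_sum2 big_ord0 add0r.
rewrite addSn !harmonic_sum2S addrAC lerD//.
by rewrite le_harmonic_sum// leq_addr.
Qed.

Lemma harmonic_sum2_le n : harmonic_sum2 n <= n%:R * harmonic_sum n.
Proof.
rewrite /harmonic_sum2 mulr_natl -[X in _ *+ X]card_ord -sumr_const.
by apply: ler_sum => i _; rewrite le_harmonic_sum// ltnW.
Qed.

Lemma absorption_time_ge0 b m : 0 <= absorption_time b m.
Proof. by rewrite divr_ge0// -addrA -opprD subr_ge0 harmonic_sum2_super. Qed.

Lemma harmonic_sum2_ge0 n : 0 <= harmonic_sum2 n.
Proof. by apply: sumr_ge0 => i _; exact: harmonic_sum_ge0. Qed.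

(** Division by [b + m] turns [harmonic_sum2 (b + m)] into an average of harmonic sums. *)
Lemma absorption_time_le b m : absorption_time b m <= harmonic_sum (b + m).
Proof.
have [bm|bm] := posnP (b + m)%N.
  by rewrite /absorption_time bm invr0 mulr0 harmonic_sum_ge0.
rewrite /absorption_time ler_pdivrMr ?ltr0n// mulrC.
apply: le_trans (harmonic_sum2_le _).
by rewrite -addrA -opprD gerBl addr_ge0// harmonic_sum2_ge0.
Qed.

(** The case of a cluster just created by an emission; the factor [1 / (m + 1)] will cancel the
    emission rate, which is proportional to the size of the pile. *)
Lemma absorption_time1 m : absorption_time 1 m = harmonic_sum m / m.+1%:R.
Proof.
rewrite /absorption_time add1n !harmonic_sum2S /harmonic_sum2 /harmonic_sum !big_ord0.
by rewrite addr0 subr0 addrAC subrr add0r.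
Qed.

(** As the total is conserved, only the second differences of [harmonic_sum2] in the two arguments
    count. With [B = b + 1] and [M = m + 1] they give [- (1 / B + 1 / M) / (B + M) = - 1 / (B *
    M)]. *)
Lemma absorption_time_drift b m :
  b.+1%:R * m.+1%:R * (absorption_time b m.+2 + absorption_time b.+2 m
    - 2 * absorption_time b.+1 m.+1) = -1.
Proof.
rewrite /absorption_time !addSn !addnS.
move: (harmonic_sum2 (b + m).+2) => total.
rewrite !harmonic_sum2S !harmonic_sumS.
have -> : (b + m).+2%:R = b.+1%:R + m.+1%:R :> R by rewrite -natrD addSn addnS.
have : b.+1%:R + m.+1%:R != 0 :> R by rewrite -natrD pnatr_eq0.
have : b.+1%:R != 0 :> R by rewrite pnatr_eq0.
have : m.+1%:R != 0 :> R by rewrite pnatr_eq0.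
move: b.+1%:R m.+1%:R => B M M0 B0 BM0.
field.
by rewrite M0 B0 BM0.
Qed.

End AbsorptionTime.

(** * Drift of the Lyapunov function *)

Section Lyapunov.
Context {R : realType} (k L N : nat) (theta d : R).
Hypotheses (L1 : (1 < L)%N) (theta0 : (0 < theta)%R) (d0 : (0 < d)%R).
Implicit Types (x y z : torus L) (eta : Omega L N).
Local Open Scope ring_scope.
Local Notation gen := (@inclusion_gen R L N theta d).

(* With this factor c, the drift - theta * c in a cluster compensates the
   total rate 2 * N * theta * d of the hops onto empty sites and leaves - 1. *)
Definition lyapunov_cst : R := (2 * N%:R * theta * d + 1) / theta.
Local Notation c := lyapunov_cst.

(** Keeps the values on clusters at most 1, the value on the remaining configurations. *)
Hypothesis c_le1 : c * harmonic_sum N <= 1.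

Definition local_lyapunov y eta : R :=
  if dispersed k eta then 0
  else if clustered k y eta then c * absorption_time (eta y) (nbr_mass eta y) else 1.

(* Either site of a two-site cluster is a possible centre; a minimum of
   supersolutions is again a supersolution. *)
Definition lyapunov eta : R :=
  local_lyapunov [arg min_(y < ord0) local_lyapunov y eta]%O eta.

Lemma lyapunov_cst_ge0 : 0 <= c.
Proof. by rewrite divr_ge0 ?(ltW theta0)// addr_ge0// !mulr_ge0// ltW. Qed.

Lemma cst_absorption_time_ge0 b m : 0 <= c * absorption_time b m.
Proof. by rewrite mulr_ge0 ?lyapunov_cst_ge0 ?absorption_time_ge0. Qed.

Lemma local_lyapunov_ge0 y eta : 0 <= local_lyapunov y eta.
Proof.
rewrite /local_lyapunov; case: ifP => // _; case: ifP => // _.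
exact: cst_absorption_time_ge0.
Qed.

Lemma local_lyapunov_le1 y eta : local_lyapunov y eta <= 1.
Proof.
rewrite /local_lyapunov; case: ifP => // _; case: ifP => // _.
apply: le_trans c_le1; rewrite ler_wpM2l ?lyapunov_cst_ge0//.
by rewrite (le_trans (absorption_time_le _ _))// le_harmonic_sum// le_nbr_mass.
Qed.

(** The value 0 on dispersed configurations is below any [c * absorption_time], so one bound serves
    whether or not a hop ends the excursion. *)
Lemma local_lyapunov_le y eta : dispersed k eta || clustered k y eta ->
  local_lyapunov y eta <= c * absorption_time (eta y) (nbr_mass eta y).
Proof.
rewrite /local_lyapunov; case: ifP => [_ _|_ /= ->//].
exact: cst_absorption_time_ge0.
Qed.

Lemma lyapunovP eta : exists2 y, lyapunov eta = local_lyapunov y eta &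
  forall z, lyapunov eta <= local_lyapunov z eta.
Proof.
by rewrite /lyapunov; case: arg_minP => // y _ ymin; exists y => // z; exact: ymin.
Qed.

Lemma lyapunov_le y eta : lyapunov eta <= local_lyapunov y eta.
Proof. by have [? _] := lyapunovP eta; exact. Qed.

(** The jump rates are nonnegative. This passes from the minimum [lyapunov] to the
    [local_lyapunov y] that attains it at [eta]. *)
Lemma inclusion_gen_le (f g : Omega L N -> R) eta :
  (forall zeta, f zeta <= g zeta) -> f eta = g eta -> gen f eta <= gen g eta.
Proof.
move=> fg fgeta; apply: ler_sum => x _; apply: ler_sum => y _.
rewrite fgeta ler_wpM2l ?lerD2r//.
by rewrite !mulr_ge0 ?addr_ge0// ltW.
Qed.

Lemma sum_torus_nbr_cst x (a : R) : 0 <= a -> \sum_(y in torus_nbr x) a <= a *+ 2.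
Proof. by move=> a0; rewrite sumr_const ler_wpMn2l// card_torus_nbr. Qed.

(** No hop can increase [lyapunov] beyond its upper bound 1. *)
Lemma lyapunov_drift1 eta : lyapunov eta = 1 -> gen lyapunov eta <= 0.
Proof.
move=> eta1; apply: sumr_le0 => x _; apply: sumr_le0 => y _.
rewrite mulr_ge0_le0 ?subr_le0//; last first.
  by rewrite eta1 (le_trans (lyapunov_le ord0 _))// local_lyapunov_le1.
by rewrite !mulr_ge0 ?addr_ge0// ltW.
Qed.

Lemma lyapunov_dispersed eta : dispersed k eta -> lyapunov eta = 0.
Proof.
by have [y -> _] := lyapunovP eta; rewrite /local_lyapunov => ->.
Qed.

Lemma lyapunov_ge0 eta : 0 <= lyapunov eta.
Proof. by have [y -> _] := lyapunovP eta; exact: local_lyapunov_ge0. Qed.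

(** All neighbours of an occupied [x] are empty, so [x] emits onto each at rate [theta * eta x * d].
    The configuration reached has value at most [c * harmonic_sum N / eta x]. The pile size cancels,
    and at most [k] piles with at most two directions each remain. *)
Lemma lyapunov_drift_dispersed eta : dispersed k eta ->
  gen lyapunov eta <= 2 * k%:R * theta * d * c * harmonic_sum N.
Proof.
move=> eta_disp; have [/independentP ind card] := andP eta_disp.
pose a := theta * d * c * harmonic_sum N.
have a0 : 0 <= a.
  by rewrite mulr_ge0 ?harmonic_sum_ge0// mulr_ge0 ?lyapunov_cst_ge0// mulr_ge0// ltW.
apply: (@le_trans _ _ (\sum_(x in occupied eta) a *+ 2)); last first.
  rewrite sumr_const -mulrnA -[leLHS]mulr_natr.
  rewrite [leRHS](_ : _ = a * (2 * k)%:R); last by rewrite /a natrM; ring.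
  by rewrite ler_wpM2l// ler_nat leq_mul2l.
rewrite [leRHS]big_mkcond/=; apply: ler_sum => x _.
rewrite in_occupied; case: posnP => [etax|etax].
  by rewrite big1// => z _; rewrite etax mulr0 !mul0r.
apply: le_trans (sum_torus_nbr_cst x _ a0); apply: ler_sum => z zx.
have etaz : eta z = 0%N.
  apply/eqP; rewrite -leqn0 leqNgt; apply/negP => etaz.
  by have := ind x z; rewrite !in_occupied etax etaz zx => /(_ isT isT).
rewrite (lyapunov_dispersed _ eta_disp) subr0 etaz addr0.
(* The centre is taken at [z], where the emitted particle is alone, so that [b = 1]. *)
have xz : x \in torus_nbr z by rewrite torus_nbr_sym.
have [hz hm] := hop_to L N L1 eta z x xz etax.
have zocc : occupied eta :\ z \subset occupied eta by exact: subD1set.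
have hdisp : dispersed k (hop eta x z) || clustered k z (hop eta x z).
  apply: hop_to_dispersed => //.
    by apply: independentS zocc _; exact/independentP.
  exact: leq_trans (subset_leq_card zocc) card.
have := le_trans (lyapunov_le z _) (local_lyapunov_le _ _ hdisp).
rewrite hz hm etaz absorption_time1 prednK; last first.
  exact: leq_trans etax (le_nbr_mass_nbr _ _ _ _ _ _).
move=> Vle; apply: (@le_trans _ _ (theta * (eta x)%:R * d *
    (c * (harmonic_sum N / (eta x)%:R)))); last first.
  have etax0 : (eta x)%:R != 0 :> R by rewrite pnatr_eq0 -lt0n.
  rewrite [leLHS](_ : _ = a)// /a; field.
  exact: etax0.
rewrite ler_wpM2l ?mulr_ge0 ?(ltW theta0) ?(ltW d0)// (le_trans Vle)//.
rewrite ler_wpM2l ?lyapunov_cst_ge0//.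
have le_x := le_nbr_mass_nbr L N eta z x xz.
apply: ler_pM; rewrite ?harmonic_sum_ge0 ?invr_ge0//.
  apply: le_harmonic_sum; rewrite (leq_trans (leq_pred _))//.
  by apply: leq_trans (le_nbr_mass L N L1 eta z); exact: leq_addl.
rewrite lef_pV2 ?posrE ?ltr0n ?ler_nat//.
exact: leq_trans le_x.
Qed.

(** The rate splits into a [d] part and an [eta x * eta z] part. The latter only allows hops between
    occupied sites; these have [y] as an endpoint, hence are moves of the birth-death chain, with
    drift at most [- theta * c]. The [d] part has total rate at most [2 * N * theta * d]. *)
Lemma lyapunov_drift_clustered y eta : ~~ dispersed k eta -> clustered k y eta ->
  gen (local_lyapunov y) eta <= -1.
Proof.
move=> eta_disp eta_clust; have /and4P[etay m0 /independentP ind card] := eta_clust.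
set b := eta y; set m := nbr_mass eta y.
pose up := c * (absorption_time b.+1 m.-1 - absorption_time b m).
pose down := c * (absorption_time b.-1 m.+1 - absorption_time b m).
have W_eta : local_lyapunov y eta = c * absorption_time b m.
  by rewrite /local_lyapunov (negPf eta_disp) eta_clust.
(* Bounds the [eta x * eta z] part for one pair, without [theta]; it vanishes unless the hop leaves
   or enters [y]. *)
pose U x z : R := (eta x)%:R * (eta z)%:R * ((x == y)%:R * down + (z == y)%:R * up).
have le_U x z : z \in torus_nbr x ->
    (eta x)%:R * (eta z)%:R * (local_lyapunov y (hop eta x z) - local_lyapunov y eta)
    <= U x z.
  move=> zx; rewrite /U; case: (posnP (eta x)) => [->|etax]; first by rewrite !mul0r.
  case: (posnP (eta z)) => [->|etaz]; first by rewrite mulr0 !mul0r.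
  rewrite ler_wpM2l ?mulr_ge0// W_eta.
  have [xy|xy] := eqVneq x y.
    have zy : z == y = false.
      by apply: contraTF zx => /eqP ->; rewrite xy torus_nbr_irr.
    rewrite zy mul0r addr0 mul1r /down mulrBr lerD2r xy.
    rewrite xy in zx etax *.
    have [hy hm] := hop_from L N L1 eta y z zx etax.
    have := hop_from_dispersed k L N L1 eta y z zx eta_clust etaz.
    by move=> /local_lyapunov_le; rewrite hy hm.
  have [zy|zy] := eqVneq z y; last first.
    have := ind x z; rewrite !in_setD1 !in_occupied xy zy etax etaz => /(_ isT isT).
    by rewrite zx.
  rewrite mul0r add0r mul1r /up mulrBr lerD2r zy.
  rewrite zy torus_nbr_sym in zx.
  have [hy hm] := hop_to L N L1 eta y x zx etax.
  have : dispersed k (hop eta x y) || clustered k y (hop eta x y).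
    by apply: hop_to_dispersed => //; exact/independentP.
  by move=> /local_lyapunov_le; rewrite hy hm.
have sumU : \sum_x \sum_(z in torus_nbr x) U x z = - c.
  transitivity (b%:R * m%:R * (down + up)).
    rewrite mulrDr /U.
    under eq_bigr do under eq_bigr do rewrite mulrDr.
    under eq_bigr do rewrite big_split/=.
    rewrite big_split/=; congr (_ + _).
      rewrite (bigD1 y)//= [X in _ + X]big1 ?addr0 => [|x /negPf xy]; last first.
        by rewrite big1// => z _; rewrite xy mul0r mulr0.
      under eq_bigr do rewrite eqxx mul1r.
      by rewrite -mulr_suml -mulr_sumr /m /nbr_mass natr_sum.
    (* Moves towards [y] are summed by their target, using the symmetry of [torus_nbr]. *)
    rewrite (exchange_big_dep xpredT)//= (bigD1 y)//=.
    rewrite [X in _ + X]big1 ?addr0 => [|z /negPf zy]; last first.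
      by rewrite big1// => x _; rewrite zy mul0r mulr0.
    under eq_bigl do rewrite torus_nbr_sym.
    under eq_bigr do rewrite eqxx mul1r [_ * b%:R]mulrC.
    by rewrite -mulr_suml -mulr_sumr /m /nbr_mass natr_sum.
  have := @absorption_time_drift R b.-1 m.-1; rewrite !prednK// => drift.
  by rewrite -[RHS]mulr1 mulNr -mulrN -drift /up /down; ring.
(* The equation that determines [lyapunov_cst]. *)
have -> : (-1 : R) = 2 * N%:R * theta * d + theta * - c.
  rewrite /c; field; exact: lt0r_neq0.
rewrite -sumU.
apply: (@le_trans _ _ (\sum_x \sum_(z in torus_nbr x)
    (theta * d * (eta x)%:R + theta * U x z))).
  apply: ler_sum => x _; apply: ler_sum => z zx.
  rewrite [theta * _ * (d + _)]mulrDr mulrDl lerD//; last first.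
    by rewrite -!mulrA ler_wpM2l ?(ltW theta0)// !mulrA le_U.
  (* The values lie in [[0, 1]], so a hop increases them by at most 1. *)
  rewrite -[leRHS]mulr1 [theta * _ * d]mulrAC.
  rewrite ler_wpM2l ?mulr_ge0 ?(ltW theta0) ?(ltW d0)//.
  by rewrite lerBlDr ler_wpDr ?local_lyapunov_ge0 ?local_lyapunov_le1.
under eq_bigr do rewrite big_split/= -[X in _ + X]mulr_sumr.
rewrite big_split/= -[X in _ + X <= _]mulr_sumr lerD2r.
apply: (@le_trans _ _ (\sum_x (theta * d * (eta x)%:R) *+ 2)).
  apply: ler_sum => x _; apply: sum_torus_nbr_cst.
  by rewrite !mulr_ge0// ltW.
rewrite sumrMnl -mulr_sumr -natr_sum (eqP (occupationP eta)).
by rewrite -[leLHS]mulr_natr le_eqVlt; apply/orP; left; apply/eqP; ring.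
Qed.

Definition lyapunov_error : R := 2 * k%:R * theta * d * c * harmonic_sum N.

Lemma lyapunov_error_ge0 : 0 <= lyapunov_error.
Proof.
rewrite mulr_ge0 ?harmonic_sum_ge0// mulr_ge0 ?lyapunov_cst_ge0//.
by rewrite !mulr_ge0// ltW.
Qed.

(** Outside dispersed configurations the indicator is paid for by the drift [-1] if the minimising
    site is a centre, and by [lyapunov eta = 1] otherwise. *)
Lemma lyapunov_drift eta :
  gen lyapunov eta <= lyapunov_error /\
  (~~ dispersed k eta)%:R <= lyapunov_error + lyapunov eta - gen lyapunov eta.
Proof.
have err0 := lyapunov_error_ge0.
have [disp|disp] := boolP (dispersed k eta) => /=.
  have := lyapunov_drift_dispersed _ disp; rewrite -/lyapunov_error => H.
  by split=> //; rewrite (lyapunov_dispersed _ disp); lra.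
have V0 := lyapunov_ge0 eta.
have [y Vy Vle] := lyapunovP eta.
have [clust|clust] := boolP (clustered k y eta).
  have := inclusion_gen_le lyapunov (local_lyapunov y) eta (lyapunov_le y) Vy.
  have := lyapunov_drift_clustered _ _ disp clust.
  by move=> ? ?; split; lra.
have V1 : lyapunov eta = 1.
  by rewrite Vy /local_lyapunov (negPf disp) (negPf clust).
by have := lyapunov_drift1 _ V1; split; lra.
Qed.

End Lyapunov.

(** * Condensed configurations as dispersed configurations *)

Section CondensedConfigurations.
Context (k L N : nat).
Hypotheses (L1 : 1 < L) (N0 : 0 < N).
Implicit Types (x y z u v : torus L) (eta : Omega L N).

Lemma arc_length_le u v : u <= v -> arc_length u v = v - u.
Proof.
move=> uv; rewrite /arc_length /= modnDmr addnBA; last exact: ltnW.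
by rewrite addnC -addnBA// modnDl modn_small// (leq_ltn_trans (leq_subr _ _)).
Qed.

Lemma arc_length_nbr u v : v \in torus_nbr u ->
  arc_length u v = 1 \/ arc_length v u = 1.
Proof.
rewrite in_set2 => /orP[] /eqP ->; rewrite -(val_Zp1 L L1) /arc_length; [left|right].
  by rewrite addrAC subrr add0r.
by rewrite opprB addrCA subrr addr0.
Qed.

Lemma arc_length_ge2 u v : u != v -> v \notin torus_nbr u -> 2 <= arc_length u v.
Proof.
move=> uv; apply: contraR; rewrite -ltnNge ltnS /arc_length.
have vE : v = (u + (v - u))%R by rewrite addrC subrK.
rewrite leq_eqVlt => /orP[/eqP arc1|].
  by rewrite vE in_set2 (_ : (v - u)%R = Zp1) ?eqxx//; apply: val_inj; rewrite val_Zp1.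
rewrite ltnS leqn0 => /eqP arc0; case/eqP: uv.
by rewrite vE (_ : (v - u)%R = 0%R) ?addr0//; exact: val_inj.
Qed.

Lemma torus_dist_ge2 u v : u != v -> v \notin torus_nbr u -> 2 <= torus_dist u v.
Proof.
move=> uv vu; rewrite leq_min !arc_length_ge2//; first by rewrite eq_sym.
by rewrite torus_nbr_sym.
Qed.

Lemma sorted_enum_torus (O : {set torus L}) :
  sorted (fun u v : torus L => u < v) (enum O).
Proof.
apply: sorted_filter; first by move=> ? ? ?; exact: ltn_trans.
rewrite -enumT; have := iota_ltn_sorted 0 L.-1.+1.
by rewrite -val_enum_ord sorted_map.
Qed.

(** Sites at distance at least 2 are not adjacent. Conversely, the occupied sites are listed by
    increasing representatives; the first is the smallest, so no arc from it wraps around and the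
    arc lengths increase. *)
Lemma condensed_dispersed eta : condensed k L N eta <-> dispersed k eta.
Proof.
split=> [[m /= mk [x [n [[_ dist] _ _ eta_xn]]]]|/andP[/independentP ind card]].
  have occx z : z \in occupied eta -> exists i, z = x i.
    rewrite in_occupied eta_xn ffunE lt0n sum_nat_eq0 negb_forall => /existsP[i].
    by rewrite muln_eq0 negb_or eqb0 negbK => /andP[_ /eqP ->]; exists i.
  apply/andP; split.
    apply/independentP => u v /occx[i ->] /occx[j ->]; apply/negP => ji.
    have [xij|] := dist i j.
      by move: ji; rewrite xij (negPf (torus_nbr_irr _ _ L1)).
    by rewrite leq_min; have [->|->] := arc_length_nbr _ _ ji; rewrite ?andbF.
  apply: (@leq_trans #|[set x i | i in 'I_m.+1]|%SET).
    apply: subset_leq_card; apply/fintype.subsetP => z /occx[i ->].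
    exact: imset_f.
  by rewrite (leq_trans (leq_imset_card _ _))// card_ord.
pose O := occupied eta; pose x i := nth ord0 (enum O) i.
have sum_eta F : \sum_(z in O) eta z * F z = \sum_z eta z * F z.
  rewrite big_mkcond; apply: eq_bigr => z _; rewrite in_occupied.
  by case: posnP => // ->; rewrite mul0n.
have card0 : 0 < #|O|.
  rewrite card_gt0; apply: contraTneq N0 => O0.
  rewrite -leqNgt -[N](eqP (occupationP eta)) big1// => z _.
  apply/eqP; rewrite -leqn0 leqNgt -in_occupied -/O O0 inE.
  by [].
have sum_O F : \sum_(i < #|O|.-1.+1) F (x i) = \sum_(z in O) F z.
  by rewrite (prednK card0) -[RHS]big_enum/= [RHS](big_nth ord0) big_mkord -cardE.
have x_occ i : i < #|O| -> x i \in O by move=> iO; rewrite -mem_enum mem_nth// -cardE.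
have x_lt i j : i < j < #|O| -> x i < x j.
  move=> /andP[ij jO].
  apply: (sorted_ltn_nth _ ord0 (sorted_enum_torus O)) => //.
  - by move=> ? ? ?; exact: ltn_trans.
  - by rewrite inE -cardE (ltn_trans ij).
  - by rewrite inE -cardE.
(* The index is the number of piles minus one; [N > 0] ensures that there is a pile. *)
exists #|O|.-1 => /=; first by rewrite (prednK card0).
have lt_O (i : 'I_#|O|.-1.+1) : i < #|O| by rewrite -[X in _ < X]prednK.
exists (fun i => x i), (fun i => eta (x i)); split.
- split=> [i j ij|i j].
    have x0i (l : 'I_#|O|.-1.+1) : x 0 <= x l.
      by case: (posnP l) => [->//|l0]; rewrite ltnW// x_lt// l0 lt_O.
    rewrite !arc_length_le ?x0i// ltn_sub2rE ?x0i//.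
    by rewrite x_lt// ij lt_O.
  have [->|xij] := eqVneq (x i) (x j); [by left|right].
  by rewrite torus_dist_ge2// ind// x_occ.
- by move=> i; rewrite -in_occupied x_occ.
- transitivity (\sum_(z in O) eta z * 1).
    under [RHS]eq_bigr do rewrite muln1.
    by rewrite -sum_O.
  by rewrite sum_eta -[RHS](eqP (occupationP eta)); under eq_bigr do rewrite muln1.
- apply/ffunP => z; rewrite ffunE.
  rewrite (sum_O (fun u => eta u * (z == u))) sum_eta (bigD1 z)//= eqxx muln1.
  by rewrite big1 ?addn0// => u uz; rewrite eq_sym (negPf uz) muln0.
Qed.

End CondensedConfigurations.

(** Occupation numbers are at most [N], so a configuration is a function into ['I_N.+1]. *)
Lemma Omega_finite (L N : nat) :
  exists e : seq (Omega L N), uniq e /\ forall eta, eta \in e.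
Proof.
pose f (g : {ffun torus L -> 'I_N.+1}) : option (Omega L N) :=
  insub [ffun x => nat_of_ord (g x)].
exists (undup (pmap f (enum {: {ffun torus L -> 'I_N.+1}}))); split=> [|eta].
  exact: undup_uniq.
rewrite mem_undup mem_pmap; apply/mapP.
exists [ffun x => inord (eta x)]; first by rewrite mem_enum.
rewrite /f (_ : [ffun _ => _] = val eta) ?valK//.
by apply/ffunP => x; rewrite !ffunE inordK// ltnS le_occupation.
Qed.

Lemma inclusion_gen_linear (R : realType) (L N : nat) (theta d a : R)
    (f g : Omega L N -> R) eta :
  inclusion_gen theta d (fun zeta => a * f zeta + g zeta)%R eta =
  (a * inclusion_gen theta d f eta + inclusion_gen theta d g eta)%R.
Proof.
rewrite /inclusion_gen mulr_sumr -big_split; apply: eq_bigr => x _ /=.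
rewrite mulr_sumr -big_split; apply: eq_bigr => y _ /=.
ring.
Qed.

(** * Harmonic sums and the logarithm *)

Section HarmonicLn.
Context {R : realType}.
Local Open Scope ring_scope.

(** This is [ln (1 + x) <= x] at [x = - 1 / (n + 1)]. *)
Lemma inv_le_ln n : (0 < n)%N -> n.+1%:R^-1 <= ln n.+1%:R - ln n%:R :> R.
Proof.
move=> n0.
have n1 : -1 < - n.+1%:R^-1 :> R by rewrite ltrN2 invf_lt1 ?ltr0n// ltr1n.
have := le_ln1Dx n1.
rewrite (_ : 1 + _ = n%:R / n.+1%:R); last first.
  by rewrite -natr1; field; rewrite natr1 pnatr_eq0.
rewrite ln_div ?posrE ?ltr0n// => le_ln.
by rewrite -lerN2 opprB.
Qed.

(** The sum is at most [1 + ln n], and [1 <= 2 * ln n] because [ln 2 >= 1 / 2]. *)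
Lemma harmonic_sum_le_ln n : (1 < n)%N -> harmonic_sum n <= 3 * ln n%:R :> R.
Proof.
move=> n1.
have H m : harmonic_sum m.+1 <= 1 + ln m.+1%:R :> R.
  elim: m => [|m IHm].
    by rewrite harmonic_sumS /harmonic_sum big_ord0 add0r invr1 ln1 addr0.
  rewrite harmonic_sumS; move: IHm (inv_le_ln m.+1 isT).
  move: (ln _) (ln _) (_^-1) (harmonic_sum _) => *; lra.
have ln2 : 2^-1 <= ln n%:R :> R.
  apply: (@le_trans _ _ (ln 2)).
    by have := inv_le_ln 1 isT; rewrite ln1 subr0.
  by rewrite ler_ln ?posrE ?ltr0n ?ler_nat// ltnW.
by have := H n.-1; rewrite prednK ?(ltnW n1)//; lra.
Qed.

End HarmonicLn.

Local Open Scope classical_set_scope.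
Local Open Scope ring_scope.

(** * Occupation times of finite-state Markov chains *)

Section FiniteStateSemigroup.
Context {R : realType} {S : choiceType} (e : seq S).
Hypotheses (e_uniq : uniq e) (e_all : forall x, x \in e).
Variable gen : (S -> R) -> S -> R.
Hypothesis gen_linear : forall a f g x,
  gen (fun y => a * f y + g y) x = a * gen f x + gen g x.

Let gen0 x : gen (fun=> 0) x = 0.
Proof.
have := gen_linear (-1) (fun=> 0) (fun=> 0) x.
by rewrite mulr0 addr0 mulN1r addNr.
Qed.

Lemma fun_indic_sum (f : S -> R) :
  f = fun x => \sum_(y <- e) f y * \1_[set y] x.
Proof.
apply/funext => x; rewrite (bigD1_seq x)//= indicE mem_set//= mulr1.
rewrite big1 ?addr0// => y /eqP yx; rewrite indicE memNset ?mulr0// => xy.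
exact/yx/esym.
Qed.

Let gen_sum (s : seq S) (f : S -> R) (g : S -> S -> R) x :
  gen (fun x => \sum_(y <- s) f y * g y x) x = \sum_(y <- s) f y * gen (g y) x.
Proof.
elim: s => [|y s IHs].
  by rewrite big_nil -[RHS](gen0 x); congr gen; apply/funext => z; rewrite big_nil.
rewrite big_cons -IHs -gen_linear; congr gen.
by apply/funext => z; rewrite big_cons.
Qed.

Let iter_gen_sum m (s : seq S) (f : S -> R) (g : S -> S -> R) x :
  iter m gen (fun x => \sum_(y <- s) f y * g y x) x =
  \sum_(y <- s) f y * iter m gen (g y) x.
Proof.
elim: m x => [//|m IHm] x; rewrite !iterS.
by rewrite -gen_sum; congr gen; apply/funext => z; exact: IHm.
Qed.

(** The second constant sums the absolute values of all matrix entries of [gen]. The geometric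
    growth lets an exponential series dominate the semigroup. *)
Lemma iter_gen_bound f : exists2 KM : R * R, 0 <= KM.2 &
  forall m x, `|iter m gen f x| <= KM.1 * KM.2 ^+ m.
Proof.
pose K := \sum_(x <- e) `|f x|.
pose M := \sum_(y <- e) \sum_(x <- e) `|gen (\1_[set y]) x|.
exists (K, M) => /= [|m]; first by do 2! apply: sumr_ge0 => ? _.
elim: m => [|m IHm] x.
  rewrite mulr1 /K (bigD1_seq x)//= lerDl.
  exact: sumr_ge0.
rewrite iterS [X in gen X](fun_indic_sum) gen_sum (le_trans (ler_norm_sum _ _ _))//.
rewrite exprSr mulrA /M mulr_sumr; apply: ler_sum => y _; rewrite normrM.
apply: ler_pM => //; rewrite (bigD1_seq x)//= lerDl.
exact: sumr_ge0.
Qed.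

(** Coefficients of the semigroup as a power series in [t], which can be differentiated termwise. *)
Definition semigroup_coeff (f : S -> R) x (m : nat) : R :=
  iter m gen f x / m`!%:R.

Lemma semigroupE t f x : semigroup gen t f x = limn (pseries (semigroup_coeff f x) t).
Proof.
rewrite /semigroup /pseries; congr (limn (series _)); apply/funext => m.
by rewrite /semigroup_coeff mulrC mulrA mulrAC.
Qed.

Lemma is_cvg_semigroup t f x : cvgn (pseries (semigroup_coeff f x) t).
Proof.
have [[K M] /= M0 KM] := iter_gen_bound f.
apply: normed_cvg.
have cM : cvgn (series (fun m => K * exp_coeff (M * `|t|) m)).
  by apply: is_cvg_seriesZ; exact: is_cvg_series_exp_coeff.
apply: series_le_cvg cM => [//=|m|m] /=.
  have K0 : 0 <= K by have := KM 0 x; rewrite mulr1; apply: le_trans.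
  by rewrite mulr_ge0// exp_coeff_ge0// mulr_ge0.
rewrite /semigroup_coeff /exp_coeff /= !normrM normfV normr_nat normrX exprMn.
rewrite [leRHS](_ : _ = K * M ^+ m * `|t| ^+ m / m`!%:R); last by rewrite !mulrA.
by rewrite [leLHS]mulrAC ler_pM2r ?invr_gt0 ?ltr0n ?fact_gt0// ler_wpM2r.
Qed.

Lemma pseries_diffs_semigroup_coeff f x :
  pseries_diffs (semigroup_coeff f x) = semigroup_coeff (gen f) x.
Proof.
apply/funext => m; rewrite /pseries_diffs /semigroup_coeff factS natrM iterSr.
by rewrite invfM mulrCA mulVKf.
Qed.

(** Differentiating the series replaces [f] by [gen f]; the generator stands inside the semigroup,
    as Dynkin's formula requires. *)
Lemma is_derive_semigroup f x t :
  is_derive t (1 : R) (fun s => semigroup gen s f x) (semigroup gen t (gen f) x).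
Proof.
under eq_fun do rewrite semigroupE.
rewrite semigroupE -pseries_diffs_semigroup_coeff.
apply: (@pseries_snd_diffs _ _ (`|t| + 1)); last first.
  by rewrite [ltRHS]ger0_norm ?ltrDl// addr_ge0.
all: rewrite ?pseries_diffs_semigroup_coeff; exact: is_cvg_semigroup.
Qed.

Lemma semigroup0 f x : semigroup gen 0 f x = f x.
Proof.
rewrite semigroupE; apply: cvg_lim => //.
apply: cvg_near_cst.
near=> n; have n0 : (0 < n)%N by near: n; exists 1%N.
rewrite /pseries seriesEnat /= -(prednK n0) big_nat_recl//= /semigroup_coeff /=.
rewrite fact0 divr1 mulr1 big1 ?addr0// => i _.
by rewrite expr0n/= mulr0.
Unshelve. all: by end_near. Qed.

(** Transfers positivity and total mass of the transition probabilities, known from the path laws,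
    to the semigroup. *)
Lemma semigroup_sum t f x :
  semigroup gen t f x = \sum_(y <- e) f y * transition gen t x y.
Proof.
rewrite semigroupE; apply: cvg_lim => //.
rewrite [X in X @ _ --> _](_ : _ = fun n =>
    \sum_(y <- e) f y * pseries (semigroup_coeff (\1_[set y]) x) t n).
  apply: cvg_big => [|y _]; first exact: add_continuous.
  apply: cvgMr; rewrite /transition semigroupE.
  exact: is_cvg_semigroup.
apply/funext => n; rewrite /pseries seriesEnat /=.
under [RHS]eq_bigr do rewrite mulr_sumr.
rewrite exchange_big /=; apply: eq_bigr => m _.
rewrite /semigroup_coeff {1}(fun_indic_sum f) iter_gen_sum 2!mulr_suml.
by apply: eq_bigr => y _; rewrite !mulrA.
Qed.

End FiniteStateSemigroup.

(** * Measurability and expectation of occupation times *)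

Section PathMeasurability.
Context {R : realType} {S : pointedType} (e : seq S).
Hypothesis e_all : forall x, x \in e.

Lemma path_at_bigcup (A : set S) (t : R) :
  [set w : path_space R S | A (w t)] =
  \bigcup_(y in A) [set w : path_space R S | w t = y].
Proof.
apply/seteqP; split => w /=; first by move=> Aw; exists (w t).
by move=> [y Ay wy]; rewrite wy.
Qed.

Lemma measurable_path_at (A : set S) (t : R) : 0 <= t ->
  measurable [set w : path_space R S | A (w t)].
Proof.
move=> t0.
rewrite path_at_bigcup; apply: fin_bigcup_measurable => [|y _].
  by apply: (@sub_finite_set _ _ [set` e]) => // y _ /=; exact: e_all.
by apply: sub_sigma_algebra; exists t, y.
Qed.

(** The mesh is eventually shorter than an interval to the right of [t] on which the path is
    constant. *)
Lemma cadlag_grid (w : cadlag R S) (t : R) : 0 <= t ->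
  exists m, forall n i, (m <= n)%N ->
    i%:R / n.+1%:R <= t -> t < i.+1%:R / n.+1%:R ->
    w (i.+1%:R / n.+1%:R) = w t.
Proof.
move=> t0; have [r /= r0 wr] := cadlag_right w t0.
have [m mr] : exists m : nat, m.+1%:R^-1 < r.
  exists (Num.truncn r^-1); rewrite invf_plt ?posrE ?ltr0n//.
  by rewrite truncnS_gt.
exists m => n i mn it ti; apply: wr => //=.
rewrite ltr0_norm ?subr_lt0// opprB ltrBlDr.
apply: (@le_lt_trans _ _ (n.+1%:R^-1 + t)).
  by rewrite -[i.+1%:R]natr1 mulrDl mul1r addrC lerD2l.
rewrite ltrD2r (le_lt_trans _ mr)// lef_pV2 ?posrE ?ltr0n//.
by rewrite ler_nat.
Qed.

(* By right continuity, the path at time t takes its value at the next point of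
   any sufficiently fine grid. *)
Lemma measurable_path_graph (A : set S) :
  measurable [set z : path_space R S * R | 0 <= z.2 /\ A (z.1 z.2)].
Proof.
(* The union over [m] of intersections over [n >= m] says that the condition holds for all large
   [n]; [i] selects the grid cell of [t]. *)
rewrite (_ : [set z | _] = \bigcup_m \bigcap_(n in [set n | (m <= n)%N]) \bigcup_i
  ([set w : path_space R S | A (w (i.+1%:R / n.+1%:R))] `*`
   `[i%:R / n.+1%:R, i.+1%:R / n.+1%:R[%classic)).
  apply: bigcup_measurable => m _; apply: bigcap_measurable => [|n _].
    by exists m => /=.
  apply: bigcup_measurable => i _; apply: measurableX => //.
  exact: measurable_path_at.
apply/seteqP; split => [[w t] /= [t0 Awt]|[w t] /=].
  have [m wm] := cadlag_grid w _ t0; exists m => // n /= mn.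
  have n0 : 0 < n.+1%:R :> R by rewrite ltr0n.
  have tn0 : 0 <= t * n.+1%:R by rewrite mulr_ge0.
  have it : (Num.truncn (t * n.+1%:R))%:R / n.+1%:R <= t.
    by rewrite ler_pdivrMr// truncn_le.
  have ti : t < (Num.truncn (t * n.+1%:R)).+1%:R / n.+1%:R.
    by rewrite ltr_pdivlMr// truncnS_gt.
  exists (Num.truncn (t * n.+1%:R)) => //; split => /=; first by rewrite wm.
  by rewrite in_itv/= it ti.
move=> [m _ Hm].
have t0 : 0 <= t.
  have [i _ [_ /=]] := Hm m (leqnn m).
  by rewrite in_itv/= => /andP[+ _]; apply: le_trans; rewrite divr_ge0.
split=> //; have [m' wm] := cadlag_grid w _ t0.
have [i _ [/= Aw]] := Hm (maxn m m') (leq_maxl _ _).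
by rewrite in_itv/= => /andP[it ti]; rewrite -(wm (maxn m m') i)// leq_maxr.
Qed.

(** Tonelli's theorem for the indicator of the measurable path graph, cut off to times in
    [[0, T]]. *)
Lemma expectation_occupation_time (P : probability (path_space R S) R)
    (A : set S) (T : R) :
  ('E_P[fun w : cadlag R S =>
      (\int[lebesgue_measure]_(t in `[0%R, T]) \1_A (w t))%R] =
   \int[lebesgue_measure]_(t in `[0%R, T]) P [set w : cadlag R S | A (w t)])%E.
Proof.
pose M := [set z : path_space R S * R | 0 <= z.2 /\ A (z.1 z.2)] `&`
  (setT `*` `[0, T]%classic).
have mM : measurable M.
  by apply: measurableI; [exact: measurable_path_graph | exact: measurableX].
have mf : measurable_fun [set: path_space R S * R] (fun z => (\1_M z)%:E : \bar R).
  by apply/measurable_EFinP; exact: measurable_indic.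
have M1 w t : 0 <= t <= T -> \1_M (w, t) = \1_A (w t) :> R.
  move=> tT; have [t0 _] := andP tT; rewrite !indicE; congr (_%:R); congr nat_of_bool.
  apply/idP/idP => /set_mem /= => [[[_ Aw] _]|Aw]; exact/mem_set.
have M0 w t : ~~ (0 <= t <= T) -> \1_M (w, t) = 0 :> R.
  move=> tT; rewrite indicE memNset// => -[_ /= [_]].
  by rewrite in_itv/= (negbTE tT).
rewrite unlock.
transitivity (\int[P]_w \int[lebesgue_measure]_t (\1_M (w, t))%:E)%E.
  apply: eq_integral => w _.
  have wM : (\int[lebesgue_measure]_(t in `[0%R, T]) (\1_A (w t))%:E =
             \int[lebesgue_measure]_t (\1_M (w, t))%:E)%E.
    rewrite [LHS]integral_mkcond; apply: eq_integral => t _.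
    rewrite patchE; case: ifPn => tT.
    - by rewrite M1//; move/set_mem : tT; rewrite /= in_itv.
    - by rewrite M0//; apply: contra tT => tT; apply/mem_set; rewrite /= in_itv.
  (* The real-valued integral is [fine] of an extended one, which must be shown finite. *)
  rewrite /Rintegral wM fineK//.
  have -> : (fun t => (\1_M (w, t))%:E) =
      (fun t => (\1_(xsection M w) t)%:E) :> (R -> \bar R).
    by apply/funext => t; rewrite !indicE mem_xsection.
  have mMw : measurable (xsection M w) by exact: measurable_xsection.
  rewrite integral_indic// setIT ge0_fin_numE//.
  apply: (@le_lt_trans _ _ (lebesgue_measure `[0, T]%classic)).
    apply: le_measure; rewrite ?inE//.
    by move=> t; rewrite /xsection/= => /set_mem[_ []].
  by rewrite lebesgue_measure_itv/=; case: ifP => _; rewrite ?ltry// -EFinB ltry.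
rewrite (fubini_tonelli (m1 := P) (m2 := lebesgue_measure) (fun z => (\1_M z)%:E))//.
rewrite [RHS]integral_mkcond; apply: eq_integral => t _.
rewrite patchE; case: ifPn => tT.
- have {}tT : 0 <= t <= T by move/set_mem : tT; rewrite /= in_itv.
  have [t0 _] := andP tT.
  under eq_integral do rewrite M1//.
  have := integral_indic P measurableT (measurable_path_at A _ t0).
  by rewrite setIT => <-.
- under eq_integral => w _.
    rewrite M0; last by apply: contra tT => tT; apply/mem_set; rewrite /= in_itv.
    over.
  by rewrite integral0.
Qed.

End PathMeasurability.

Lemma continuous_measurable_on (R : realType) (D : set R) (f : R -> R) :
  measurable D -> continuous f -> measurable_fun D f.
Proof.
by move=> mD cf; apply: measurable_funS (continuous_measurable_fun cf).
Qed.

(** * Dynkin's formula and the occupation time bound *)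

Section OccupationTime.
Context {R : realType} {S : pointedType} (e : seq S).
Hypotheses (e_uniq : uniq e) (e_all : forall x, x \in e).
Variables (gen : (S -> R) -> S -> R) (P : S -> probability (path_space R S) R).
Hypothesis gen_linear : forall a f g x,
  gen (fun y => a * f y + g y) x = a * gen f x + gen g x.
Hypothesis P_law : forall x, markov_law gen x (P x).

Lemma markov_law_transition t x y : 0 <= t ->
  P x [set w : cadlag R S | w t = y] = (transition gen t x y)%:E.
Proof.
move=> t0; have [_ /(_ [:: (t, y)])] := P_law x.
rewrite /= andbT mulr1 => /(_ t0) <-; congr (P x _).
by apply/seteqP; split => w /=; rewrite add0r; [split | case].
Qed.

Lemma markov_law_semigroup (A : set S) t x : 0 <= t ->
  P x [set w : cadlag R S | A (w t)] = (semigroup gen t (\1_A) x)%:E.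
Proof.
move=> t0; rewrite path_at_bigcup.
have finA : finite_set A.
  by apply: (@sub_finite_set _ _ [set` e]) => // y _ /=; exact: e_all.
rewrite measure_fin_bigcup//=; last 2 first.
- by move=> y z _ _ [w [/= <- <-]].
- by move=> y _; exact: (measurable_path_at _ e_all [set y] _ t0).
under eq_fsbigr do rewrite markov_law_transition//.
rewrite (semigroup_sum e)// fsumEFin//; congr EFin.
rewrite (fsbig_seq _ _ e_uniq) -(fsbig_widen A); last 2 first.
- by move=> y _; exact: e_all.
- by move=> y [_ nAy] /=; rewrite indicE memNset// mul0r.
by apply: eq_fsbigr => y yA; rewrite indicE yA mul1r.
Qed.

(** Transition probabilities are nonnegative, being values of the measure [P x]. *)
Lemma semigroup_le t f g x : 0 <= t -> (forall y, f y <= g y) ->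
  semigroup gen t f x <= semigroup gen t g x.
Proof.
move=> t0 fg; rewrite !(semigroup_sum e)//; apply: ler_sum => y _.
by rewrite ler_wpM2r// -lee_fin -markov_law_transition.
Qed.

Lemma transition_sum1 t x : 0 <= t -> \sum_(y <- e) transition gen t x y = 1.
Proof.
move=> t0; have := markov_law_semigroup setT _ x t0.
rewrite (_ : [set w | _] = setT) ?probability_setT; last exact/seteqP.
case=> ->; rewrite (semigroup_sum e)//; apply: eq_bigr => y _.
by rewrite indicT mul1r.
Qed.

(** Integrated over [[0, T]], the term [- gen V] contributes [V x] minus the mean of [V] at time
    [T], which is at most 0; the mean of [eps + V] stays below [eps * (1 + T)]. *)
Lemma occupation_time_le (A : set S) (V : S -> R) (eps T : R) x :
  0 < T -> 0 <= eps -> (forall y, 0 <= V y) -> V x = 0 ->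
  (forall y, gen V y <= eps) -> (forall y, \1_A y <= eps + V y - gen V y) ->
  ('E_(P x)[fun w : cadlag R S =>
      (\int[lebesgue_measure]_(t in `[0%R, T]) \1_A (w t))%R] <=
   (eps * T * (1 + T))%:E)%E.
Proof.
move=> T0 eps0 V0 Vx genV AV.
have dF t : is_derive t (1 : R) (fun s => semigroup gen s V x)
    (semigroup gen t (gen V) x).
  exact: (is_derive_semigroup e).
have cF f : continuous (fun t => semigroup gen t f x).
  move=> t; apply/differentiable_continuous/derivable1_diffP.
  by have [] := is_derive_semigroup _ e_uniq e_all _ gen_linear f x t.
have eps_semigroup t : 0 <= t -> semigroup gen t (gen V) x <= eps.
  move=> t0; rewrite (le_trans (semigroup_le _ (gen V) (fun=> eps) _ t0 genV))//.
  by rewrite (semigroup_sum e)// -mulr_sumr transition_sum1 ?mulr1.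
have V_semigroup t : 0 <= t -> semigroup gen t V x <= eps * t.
  rewrite le_eqVlt => /predU1P[<-|t0]; first by rewrite semigroup0 ?Vx ?mulr0.
  have [|c] := MVT t0 (fun s _ => dF s); first exact/continuous_subspaceT/cF.
  rewrite in_itv/= subr0 semigroup0// Vx subr0 => /andP[c0 _] ->.
  by rewrite ler_wpM2r ?(ltW t0)// eps_semigroup// ltW.
(* Bounds the mean of [eps + V] uniformly on [[0, T]]. *)
pose C := eps + eps * T.
have A_semigroup t : 0 <= t <= T ->
    semigroup gen t (\1_A) x <= C - semigroup gen t (gen V) x.
  move=> /andP[t0 tT].
  have := semigroup_le _ (\1_A) (fun y => eps + V y - gen V y) x t0 AV.
  move=> /le_trans; apply.
  rewrite (semigroup_sum e)//.
  under eq_bigr do rewrite mulrBl mulrDl.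
  rewrite sumrB big_split/= -mulr_sumr transition_sum1// mulr1.
  rewrite -!(semigroup_sum e)// lerD2r /C lerD2l (le_trans (V_semigroup _ t0))//.
  by rewrite ler_wpM2l.
rewrite (expectation_occupation_time e)//.
apply: (@le_trans _ _ (\int[lebesgue_measure]_(t in `[0%R, T])
    (C - semigroup gen t (gen V) x)%:E)%E).
  under eq_integral => t /set_mem/=.
    rewrite in_itv/= => /andP[t0 _].
    rewrite (markov_law_semigroup _ _ x t0); over.
  apply: ge0_le_integral => //.
  - by move=> t /=; rewrite in_itv/= => /andP[t0 _]; rewrite -markov_law_semigroup.
  - by apply/measurable_EFinP; apply: continuous_measurable_on => //; exact: cF.
  - apply/measurable_EFinP; apply: continuous_measurable_on => // t.
    by apply: cvgB; [exact: cvg_cst | exact: cF].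
(* An explicit antiderivative of the upper bound, for the fundamental theorem of calculus. *)
have dCF t : is_derive t (1 : R) (fun t => C * t - semigroup gen t V x)
    (C - semigroup gen t (gen V) x).
  apply: is_deriveB; rewrite -[X in is_derive _ _ _ X]mulr1.
  exact: is_deriveZ.
have cCF : continuous (fun t => C * t - semigroup gen t V x).
  move=> t; apply/differentiable_continuous/derivable1_diffP.
  by have [] := dCF t.
rewrite (@continuous_FTC2 _ _ (fun t => C * t - semigroup gen t V x))//.
- rewrite mulr0 semigroup0 Vx subr0 sube0 lee_fin.
  rewrite [leRHS](_ : _ = C * T); last by rewrite /C; ring.
  (* The mean of [V] at time [T] is nonnegative, by comparison with the zero function. *)
  rewrite gerBl -[leLHS](_ : semigroup gen T (fun=> 0) x = 0).
    exact/semigroup_le/V0/ltW.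
  by rewrite (semigroup_sum e)// big1// => y _; rewrite mul0r.
- apply: continuous_subspaceT => t.
  by apply: cvgB; [exact: cvg_cst | exact: cF].
- split=> [t _||].
  + by have [] := dCF t.
  + exact/cvg_at_right_filter/cCF.
  + exact/cvg_at_left_filter/cCF.
- by move=> t _; rewrite derive1E; have [_ ->] := dCF t.
Qed.

End OccupationTime.

(** * The inclusion process *)

Lemma time_not_condensed_le (R : realType) (k L N : nat) (theta d T : R)
    (P : Omega L N -> probability (path_space R (Omega L N)) R) xi :
  (1 < L)%N -> (0 < N)%N -> 0 < theta -> 0 < d -> 0 < T ->
  lyapunov_cst N theta d * harmonic_sum N <= 1 ->
  (forall eta, markov_law (inclusion_gen theta d) eta (P eta)) ->
  condensed k L N xi ->
  ('E_(P xi)[fun w : cadlag R (Omega L N) =>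
      (\int[lebesgue_measure]_(t in `[0%R, T])
          \1_(~` condensed k L N) (w t))%R] <=
    (lyapunov_error k N theta d * T * (1 + T))%:E)%E.
Proof.
move=> L1 N0 theta0 d0 T0 c_le1 P_law xi_cond.
have [e [e_uniq e_all]] := Omega_finite L N.
have drift := lyapunov_drift k L N theta d L1 theta0 d0 c_le1.
have cond_disp eta := condensed_dispersed k L N L1 N0 eta.
apply: (occupation_time_le e e_uniq e_all (inclusion_gen theta d) P
  (@inclusion_gen_linear R L N theta d) P_law _ (lyapunov k L N theta d)) => //.
- exact: lyapunov_error_ge0.
- exact: lyapunov_ge0.
- by apply: lyapunov_dispersed; apply/cond_disp.
- by move=> eta; have [] := drift eta.
- move=> eta; have [_] := drift eta; apply: le_trans.
  rewrite indicE; have [disp|disp] := boolP (dispersed k eta).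
    by rewrite memNset//= => /(_ (proj2 (cond_disp eta) disp)).
  by rewrite lern1 leq_b1.
Qed.

(** Prevents the supremum from being [-oo]. The witness [point] has all particles at one site. *)
Lemma condensed_nonempty (k L N : nat) : (1 <= k)%N -> (1 < L)%N -> (0 < N)%N ->
  condensed k L N !=set0.
Proof.
move=> k1 L1 N0; exists point; apply/condensed_dispersed => //.
have occ : occupied (point : Omega L N) \subset [set ord0]%SET.
  apply/fintype.subsetP => z; rewrite in_occupied finset.in_set1 ffunE.
  by case: eqP => //; rewrite muln0.
apply/andP; split; last first.
  by rewrite (leq_trans (subset_leq_card occ))// cards1.
apply: (independentS _ _ _ occ); apply/independentP => x z.
by rewrite !finset.in_set1 => /eqP -> /eqP ->; exact: torus_nbr_irr.
Qed.

(** Here [c = d * (2 * N^3 + 1) / N^2]; the 9 combines [2 * N^3 + 1 <= 3 * N^3] with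
    [harmonic_sum N <= 3 * ln N]. *)
Lemma lyapunov_cst_le (R : realType) (N : nat) (d : R) : (1 < N)%N -> 0 < d ->
  lyapunov_cst N (N%:R ^+ 2 / d) d * harmonic_sum N <=
  9 * (d * N%:R ^+ 3 * ln N%:R) / N%:R ^+ 2.
Proof.
move=> N1 d0; have N0 : 1 <= N%:R :> R by rewrite ler1n ltnW.
have n0 : N%:R != 0 :> R by rewrite gt_eqF// (lt_le_trans ltr01).
have N3 : 1 <= N%:R ^+ 3 :> R by exact: exprn_ege1.
rewrite (_ : lyapunov_cst _ _ _ = d * (2 * N%:R ^+ 3 + 1) / N%:R ^+ 2); last first.
  by rewrite /lyapunov_cst; field; rewrite n0 gt_eqF.
rewrite mulrAC ler_pM2r ?invr_gt0 ?exprn_gt0 ?(lt_le_trans ltr01)//.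
have -> : 9 * (d * N%:R ^+ 3 * ln N%:R) = d * (3 * N%:R ^+ 3) * (3 * ln N%:R) by ring.
apply: ler_pM; rewrite ?harmonic_sum_ge0 ?harmonic_sum_le_ln//.
  by apply: mulr_ge0; [exact: ltW | lra].
by rewrite ler_pM2l//; lra.
Qed.

(** As [theta * d = N^2], the error is [2 * k * N^2] times the quantity bounded in
    [lyapunov_cst_le]. *)
Lemma lyapunov_error_le (R : realType) (k N : nat) (d : R) : (1 < N)%N -> 0 < d ->
  lyapunov_error k N (N%:R ^+ 2 / d) d <= 18 * k%:R * (d * N%:R ^+ 3 * ln N%:R).
Proof.
move=> N1 d0; have n0 : 0 < N%:R :> R by rewrite ltr0n ltnW.
rewrite (_ : lyapunov_error _ _ _ _ = 2 * k%:R * (N%:R ^+ 2 *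
    (lyapunov_cst N (N%:R ^+ 2 / d) d * harmonic_sum N))); last first.
  rewrite /lyapunov_error; set c := lyapunov_cst _ _ _.
  by field; rewrite gt_eqF.
rewrite (_ : 18 * _ * _ = 2 * k%:R * (9 * (d * N%:R ^+ 3 * ln N%:R))); last by ring.
rewrite ler_wpM2l// mulrC -ler_pdivlMr ?exprn_gt0//.
exact: lyapunov_cst_le.
Qed.

Theorem theorem1p3 (R : realType) (k : nat) (rho : R) (L : nat -> nat)
  (d : nat -> R)
  (P : forall N : nat, Omega (L N) N ->
         probability (path_space R (Omega (L N) N)) R)
  (hk : (1 <= k)%N) (hrho : 0 < rho)
  (hL0 : forall N, (0 < L N)%N)
  (hL : L N @[N --> \oo] --> \oo)
  (hLrho : N%:R / (L N)%:R @[N --> \oo] --> rho)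
  (hd0 : forall N, 0 < d N)
  (hd : d N * N%:R ^+ 3 * ln N%:R @[N --> \oo] --> (0 : R))
  (hP : forall N (eta : Omega (L N) N),
     markov_law (inclusion_gen (N%:R ^+ 2 / d N) (d N)) eta (P N eta))
  (T : R) (hT : 0 < T) :
  ereal_sup
    [set 'E_(P N xi)[fun w : cadlag R (Omega (L N) N) =>
           (\int[lebesgue_measure]_(t in `[0%R, T])
              \1_(~` condensed k (L N) N) (w t))%R]%E
       | xi in condensed k (L N) N]
    @[N --> \oo] --> 0%E.
Proof.
pose u N := d N * N%:R ^+ 3 * ln N%:R.
have u0 : 18 * k%:R * u N * T * (1 + T) @[N --> \oo] --> (0 : R).
  rewrite -(mul0r (1 + T)) -(mul0r T) -(mulr0 (18 * k%:R)).
  by do 2! apply: cvgMr_tmp; exact: cvgMl_tmp.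
apply: (@squeeze_cvge _ _ _ _ (fun=> 0%E) _
  (fun N => (18 * k%:R * u N * T * (1 + T))%:E)).
- near=> N.
  have L1 : (1 < L N)%N.
    near: N; apply: (hL [set n | (1 < n)%N]); exists 2%N => //.
  have N1 : (1 < N)%N by near: N; exists 2%N.
  (* Eventually true because [u] tends to 0; it yields the smallness condition on [lyapunov_cst]. *)
  have u9 : 9 * u N <= 1.
    rewrite -ler_pdivlMl// mulr1; near: N.
    by apply: (cvgr_le 0 hd); rewrite invr_gt0.
  have theta0 : 0 < N%:R ^+ 2 / d N by rewrite divr_gt0 ?exprn_gt0// ltr0n ltnW.
  apply/andP; split.
    (* A single starting configuration, with its nonnegative expectation, bounds the supremum from
       below. *)
    have [xi xi_cond] := condensed_nonempty k (L N) N hk L1 (ltnW N1).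
    apply: le_ereal_sup_tmp; eexists; first by exists xi.
    rewrite unlock; apply: integral_ge0 => w _; rewrite lee_fin.
    by apply: fine_ge0; apply: integral_ge0 => t _; rewrite lee_fin.
  apply: ge_ereal_sup => _ [xi xi_cond <-].
  apply: (le_trans (time_not_condensed_le _ k _ _ _ _ _ (P N) _
    L1 (ltnW N1) theta0 (hd0 N) hT _ (hP N) xi_cond)).
    apply: (le_trans (lyapunov_cst_le _ _ _ N1 (hd0 N))).
    rewrite ler_pdivrMr ?exprn_gt0 ?ltr0n 1?ltnW// mul1r (le_trans u9)//.
    by rewrite exprn_ege1// ler1n ltnW.
  rewrite lee_fin ler_wpM2r ?addr_ge0 ?(ltW hT)// ler_wpM2r ?(ltW hT)//.
  exact: lyapunov_error_le.
- exact: cvg_cst.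
- by apply: cvg_EFin; [exact: nearW | exact: u0].
Unshelve. all: by end_near. Qed.
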